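(* Let $q$ be a prime and let $0<\alpha<1$. Then for $\mu_\alpha$-almost every $x\in X$, $$\lim_{n\to\infty}\frac1n\sum_{j=0}^{n-1}\left|e^{2\pi i\, d_j(x)/q}-1\right|=0 .$$
   Context: The Pascal graph is the directed infinite graph with vertices $(n,k)$, $n=0,1,2,\dots$, $0\le k\le n$, with two edges leaving each vertex $(n,k)$: one to $(n+1,k)$, labelled $0$, and one to $(n+1,k+1)$, labelled $1$. $X$ is the space of infinite paths starting at the root $(0,0)$; reading edge labels identifies $X$ with $\Omega=\{0,1\}^{\mathbb N}$ (with its product $\sigma$-algebra). For $x\in X$, $k_n(x)$ is the number of $1$'s among the first $n$ labels of $x$, so the $n$-th vertex of $x$ is $(n,k_n(x))$, and $d_n(x)=\binom{n}{k_n(x)}$. For $0<\alpha<1$, $\mu_\alpha=\mathcal B(\alpha,1-\alpha)$ is the Bernoulli product measure on $X=\{0,1\}^{\mathbb N}$ for which the coordinates are independent, each equal to $0$ with probability $\alpha$ and to $1$ with probability $1-\alpha$. *)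

(* Defs.v *)
From HB Require Import structures.
From mathcomp Require Import all_boot all_order all_algebra.
From mathcomp Require Import complex.
From mathcomp Require Import all_classical all_reals all_analysis.

Set Implicit Arguments.
Unset Strict Implicit.
Unset Printing Implicit Defensive.

Import Order.TTheory GRing.Theory Num.Theory.
Import numFieldNormedType.Exports.

Local Open Scope classical_set_scope.
Local Open Scope ring_scope.

(* An infinite path from the root of the Pascal graph is identified with its
   sequence of edge labels: [x i = b] says that the edge leaving level [i] has
   label 1 if [b] is [true] and label 0 if [b] is [false]. *)

Definition coord (i : nat) (x : nat -> bool) : bool := x i.

Definition cylinders : set_system (nat -> bool) :=
  [set A | exists i (B : set bool), A = coord i @^-1` B].

(* The path space with its product sigma-algebra. *)
Definition pascal_path := g_sigma_algebraType cylinders.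

(* The path [x] visits the vertex [(n, kn x n)] at level [n]. *)
Definition kn (x : pascal_path) (n : nat) : nat := (\sum_(i < n) coord i x)%N.

Definition dn (x : pascal_path) (n : nat) : nat := 'C(n, kn x n).

(* [mu] is the product measure B(alpha, 1 - alpha): the coordinates are mutually
   independent, with law alpha at 0 and 1 - alpha at 1. *)
Definition is_bernoulli (R : realType) (alpha : R)
    (mu : probability pascal_path R) : Prop :=
  [/\ forall i : nat, mu (coord i @^-1` [set false]) = alpha%:E,
      forall i : nat, mu (coord i @^-1` [set true]) = (1 - alpha)%:E
    & forall (s : seq nat) (B : nat -> set bool), uniq s ->
        mu (\bigcap_(i in [set` s]) (coord i @^-1` B i)) =
        (\prod_(i <- s) mu (coord i @^-1` B i))%E].

(* exp (i t) for real t. *)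
Definition expi (R : realType) (t : R) : R[i] := Complex (cos t) (sin t).

(* Main.v *)
Require Import Defs.
From HB Require Import structures.
From mathcomp Require Import all_boot all_order all_algebra.
From mathcomp Require Import complex.
From mathcomp Require Import all_classical all_reals all_analysis.
From mathcomp Require Import measurable_realfun ring lra zify.
Import Order.TTheory GRing.Theory Num.Theory.
Import numFieldNormedType.Exports.
(* [vector.coord] would otherwise shadow [Defs.coord]. *)
Import Defs.

(** The [j]-th term vanishes when [q] divides [d_j(x)] and is at most 2
    otherwise, so it suffices that the levels [j] with [~ q | d_j(x)] have
    density 0 for almost every [x].

    Let [Q = q ^ h]. By Lucas, [~ q | C(j, k)] forces
    [~ q | C(j mod Q, k mod Q)], and at most [(q^2 - 1)^h] of the [Q^2] pairs of
    residues satisfy the latter. The law of [k_j mod Q] is that of a lazy walk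
    on the cycle of length [Q]; an energy argument bounds its masses by [2 / Q]
    as soon as [alpha (1 - alpha) j >= Q^4]. Summing over [j < Q^5], the
    expected proportion of such levels below [Q^5 = (q^5)^h] is
    [O((1 - 1/q^2)^h)]. This is summable in [h], so almost surely the proportion
    tends to 0 along the powers of [q^5], hence along all [n] by monotonicity of
    the counts. *)

(** * Binomial coefficients modulo a prime *)

(** If [q] did not divide the coefficient, [q ^ h] would be coprime to it, and the absorption
    identity would make [q ^ h] divide the smaller number [i]. *)
Lemma prime_dvd_bin_exp (q h i : nat) :
  prime q -> (0 < i < q ^ h)%N -> q %| 'C(q ^ h, i).
Proof.
move=> q_pr /andP[i0 iQ]; case: i i0 iQ => // i _ iQ.
apply: contraTT iQ => ndvd; rewrite -leqNgt dvdn_leq //.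
have cop : coprime (q ^ h) 'C(q ^ h, i.+1) by rewrite coprimeXl // prime_coprime.
by rewrite -(Gauss_dvdl _ cop) -mul_bin_diag dvdn_mulr.
Qed.

(** Coefficient form of (1 + X)^Q = 1 + X^Q modulo [q], for Q = [q ^ h]: in Vandermonde's sum only
    the terms of index 0 and Q survive. *)
Lemma modn_bin_addl_exp (q h n k : nat) : prime q ->
  'C(q ^ h + n, k) = 'C(n, k) + (q ^ h <= k) * 'C(n, k - q ^ h) %[mod q].
Proof.
move=> q_pr; have Q0 : 0 < q ^ h by rewrite expn_gt0 prime_gt0.
rewrite -binomial.Vandermonde big_ord_recl bin0 mul1n subn0.
apply/eqP; rewrite eqn_modDl; apply/eqP.
have mod0 (s : 'I_k) : (bump 0 s) != q ^ h ->
    'C(q ^ h, bump 0 s) * 'C(n, k - bump 0 s) = 0 %[mod q].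
  move=> ne; rewrite mod0n; apply/eqP; rewrite -/(dvdn _ _) dvdn_mulr //.
  have [lt|le] := ltnP (bump 0 s) (q ^ h); first exact: prime_dvd_bin_exp.
  by rewrite bin_small // ltn_neqAle eq_sym ne.
rewrite -modn_summ.
have [Qk|kQ] := leqP (q ^ h) k; last first.
  rewrite mul0n big1 // => s _; rewrite mod0 ?mod0n // neq_ltn /bump leq0n /= add1n.
  by rewrite (leq_ltn_trans (ltn_ord s) kQ).
have sQ : (q ^ h).-1 < k by rewrite prednK.
rewrite (bigD1 (Ordinal sQ)) //= [X in _ + X]big1 ?addn0.
  by rewrite modn_mod /bump leq0n /= add1n prednK // binn.
move=> s ne; rewrite mod0 ?mod0n //.
apply: contraNneq ne => e; apply/eqP/val_inj => /=; rewrite -e.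
by rewrite /bump leq0n add1n.
Qed.

(* One step of Lucas' theorem, by induction on the quotient of [n] by [q ^ h]. *)
Lemma dvdn_bin_modn_exp (q h n k : nat) : prime q ->
  q %| 'C(n %% q ^ h, k %% q ^ h) -> q %| 'C(n, k).
Proof.
move=> q_pr; have Q0 : 0 < q ^ h by rewrite expn_gt0 prime_gt0.
rewrite {2}(divn_eq n (q ^ h)); set s := n %% _.
have sQ : s < q ^ h by rewrite ltn_mod.
elim: (n %/ q ^ h) k => [|m IH] k dv.
  rewrite mul0n add0n; have [kQ|Qk] := ltnP k (q ^ h).
    by rewrite modn_small in dv.
  by rewrite bin_small // (leq_trans sQ).
rewrite mulSn -addnA /dvdn modn_bin_addl_exp // -/(dvdn _ _) dvdn_add ?IH //.
case: leqP => Qk; rewrite ?mul0n // mul1n IH //.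
by rewrite -(subnK Qk) modnDr in dv.
Qed.

Lemma sum_nat_divmod (m d : nat) (F : nat -> nat) :
  \sum_(i < m * d) F i = \sum_(a < m) \sum_(s < d) F (a * d + s).
Proof.
rewrite -(big_mkord predT F) big_nat_mul big_mkord; apply: eq_bigr => a _.
rewrite mulSn -{1}[a * d]add0n big_addn addnK big_mkord.
by apply: eq_bigr => s _; rewrite addnC.
Qed.

(** Cut the square of side [q ^ h.+1] into [q ^ 2] blocks of side [q ^ h]. By the Lucas step, each
    block has nonzero residues at most where the corner block has them. Block (0, 1) lies above the
    diagonal and vanishes, so each step multiplies the count by at most [(q ^ 2).-1]. *)
Lemma sum_bin_ndvdn_le (q h : nat) : prime q ->
  \sum_(n < q ^ h) \sum_(k < q ^ h) ~~ (q %| 'C(n, k)) <= (q ^ 2).-1 ^ h.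
Proof.
move=> q_pr; have q1 := prime_gt1 q_pr.
elim: h => [|h IH]; first by rewrite !big_ord1 dvdn1 neq_ltn q1 orbT.
have Q0 : 0 < q ^ h by rewrite expn_gt0 prime_gt0.
pose b n k : nat := ~~ (q %| 'C(n, k)).
rewrite expnS (sum_nat_divmod q (q ^ h) (fun n => \sum_(k < q * q ^ h) b n k)).
under eq_bigr => a _ do under eq_bigr => s _ do
  rewrite (sum_nat_divmod q (q ^ h) (b (a * q ^ h + s))).
pose T := \sum_(s < q ^ h) \sum_(r < q ^ h) ~~ (q %| 'C(s, r)).
pose ok (a c : nat) : bool := (a, c) != (0, 1).
apply: (@leq_trans (\sum_(a < q) \sum_(c < q) ok a c * T)).
  apply: leq_sum => a _; rewrite exchange_big /=; apply: leq_sum => c _.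
  rewrite big_distrr /=; apply: leq_sum => s _.
  rewrite big_distrr /=; apply: leq_sum => r _.
  rewrite /b; have [ac|] := boolP (ok a c); last first.
    rewrite negbK => /eqP[-> ->].
    rewrite mul0n mul1n add0n bin_small ?dvdn0 //.
    by rewrite (leq_trans (ltn_ord s)) // leq_addr.
  rewrite mul1n; case: (boolP (q %| 'C(s, r))) => dv; last by rewrite leq_b1.
  by rewrite (@dvdn_bin_modn_exp q h) // !modnMDl !modn_small.
rewrite -(@eq_bigr _ _ _ _ _ _ (fun a : 'I_q => (\sum_(c < q) ok a c) * T)); last first.
  by move=> a _; rewrite big_distrl.
rewrite -big_distrl /= expnS leq_mul // {IH}.
rewrite pair_big /= (_ : \sum_p _ = #|[pred p : 'I_q * 'I_q | ok p.1 p.2]|); last first.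
  by rewrite -sum1_card [RHS]big_mkcond.
have q0 := ltnW q1.
rewrite (_ : q ^ 2 = #|{: 'I_q * 'I_q}|); last by rewrite card_prod !card_ord mulnn.
rewrite -(cardC1 (Ordinal q0, Ordinal q1)).
apply: subset_leq_card; apply/fintype.subsetP => -[a c]; rewrite !inE /ok /=.
by apply: contraNneq => -[-> ->].
Qed.

Local Open Scope classical_set_scope.
Local Open Scope ring_scope.

(** * A discrete Poincare inequality *)

Lemma sqr_sum_le (R : realFieldType) (m n : nat) (f : nat -> R) :
  (\sum_(m <= i < n) f i) ^+ 2 <= (n - m)%:R * \sum_(m <= i < n) f i ^+ 2.
Proof.
have -> : (n - m)%:R * \sum_(m <= i < n) f i ^+ 2 =
  \sum_(m <= i < n) \sum_(m <= j < n) (f i ^+ 2 + f j ^+ 2) / 2.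
  under [RHS]eq_bigr => i _ do rewrite -mulr_suml big_split /= sumr_const_nat.
  rewrite -mulr_suml big_split /= sumr_const_nat sumrMnl -mulr_natl; by field.
rewrite expr2 big_distrlr /=; apply: ler_sum => i _; apply: ler_sum => j _.
have := sqr_ge0 (f i - f j); nra.
Qed.

(** Telescope from [s] to [r] and apply Cauchy-Schwarz to at most [n] increments. *)
Lemma sqr_sub_le_sum_step (R : realFieldType) (n : nat) (f : nat -> R) (r s : nat) :
  (r < n)%N -> (s < n)%N ->
  (f r - f s) ^+ 2 <= n%:R * \sum_(0 <= i < n) (f i.+1 - f i) ^+ 2.
Proof.
wlog sr : r s / (s <= r)%N => [hw rn sn|rn _].
  by case: (leqP s r) => [|/ltnW] sr; [|rewrite -[_ - _]opprB sqrrN]; apply: hw.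
rewrite -telescope_sumr //; apply: (le_trans (sqr_sum_le _ s r (fun i => f i.+1 - f i))).
apply: ler_pM; first exact: ler0n.
- by apply: sumr_ge0 => i _; exact: sqr_ge0.
- by rewrite ler_nat (leq_trans (leq_subr _ _)) // ltnW.
rewrite (@big_cat_nat _ _ _ r 0 n) //=; last exact: ltnW.
rewrite (@big_cat_nat _ _ _ s 0 r) //= addrAC lerDr.
by apply: addr_ge0; apply: sumr_ge0 => i _; exact: sqr_ge0.
Qed.

(** As the mass is 1, the left side is the sum of [(f r - f s) ^+ 2] over all pairs, divided by
    [2 * n]. Each of the [n ^ 2] pairs contributes at most [n] times the Dirichlet sum; the
    remaining factor 1/2 is dropped. *)
Lemma variance_poincare (R : realFieldType) (n : nat) (f : nat -> R) :
  (0 < n)%N -> \sum_(0 <= i < n) f i = 1 ->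
  \sum_(0 <= i < n) f i ^+ 2 - n%:R^-1 <=
    n%:R ^+ 2 * \sum_(0 <= i < n) (f i.+1 - f i) ^+ 2.
Proof.
move=> n0 f1; set D := \sum_(0 <= i < n) (_ - _) ^+ 2.
have nR0 : n%:R != 0 :> R by rewrite pnatr_eq0 -lt0n.
have -> : \sum_(0 <= i < n) f i ^+ 2 - n%:R^-1 =
    (2 * n%:R)^-1 * \sum_(0 <= r < n) \sum_(0 <= s < n) (f r - f s) ^+ 2.
  under [in RHS]eq_bigr => r _ do under eq_bigr => s _ do rewrite sqrrB.
  under [in RHS]eq_bigr => r _ do rewrite big_split sumrB /= sumr_const_nat subn0
    sumrMnl -mulr_sumr f1 mulr1.
  rewrite big_split sumrB /= sumr_const_nat subn0 !sumrMnl f1.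
  by field.
rewrite mulrC ler_pdivrMr ?mulr_gt0 ?ltr0n //.
apply: (@le_trans _ _ (\sum_(0 <= r < n) \sum_(0 <= s < n) n%:R * D)).
  rewrite !big_mkord; apply: ler_sum => r _; rewrite !big_mkord.
  by apply: ler_sum => s _; exact: sqr_sub_le_sum_step.
rewrite !sumr_const_nat subn0.
have D0 : 0 <= D by apply: sumr_ge0 => i _; exact: sqr_ge0.
rewrite [leLHS](_ : _ = n%:R ^+ 2 * (n%:R * D)); last by ring.
have : 0 <= n%:R ^+ 2 * (n%:R * D) by rewrite !mulr_ge0 // exprn_ge0.
lra.
Qed.

(** * The lazy walk on a cycle *)

Lemma sum_shift_periodic (R : nmodType) (n : nat) (f : nat -> R) :
  f n = f 0%N -> \sum_(0 <= i < n) f i.+1 = \sum_(0 <= i < n) f i.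
Proof.
case: n => [|n] fn; first by rewrite !big_geq.
by rewrite big_nat_recr // fn [RHS]big_nat_recl //= addrC.
Qed.

(* The law modulo [Q] of the number of ones among [j] independent bits, as a
   [Q]-periodic function; [i + Q.-1] stands for [i - 1]. *)
Fixpoint residue_law (R : pzRingType) (alpha : R) (Q j i : nat) : R :=
  if j is j'.+1 then
    alpha * residue_law R alpha Q j' i
    + (1 - alpha) * residue_law R alpha Q j' (i + Q.-1)
  else (Q %| i)%:R.

Lemma residue_law_periodic (R : pzRingType) (alpha : R) (Q j i : nat) :
  residue_law R alpha Q j (i + Q) = residue_law R alpha Q j i.
Proof.
elim: j i => [|j IH] i /=; first by rewrite dvdn_addl.
by rewrite IH addnAC IH.
Qed.

(** Evaluating at a successor turns [i.+1 + Q.-1] into [i] by periodicity; sums over a period are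
    shifted by one to use this form. *)
Lemma residue_lawSS (R : pzRingType) (alpha : R) (Q j i : nat) : (0 < Q)%N ->
  residue_law R alpha Q j.+1 i.+1 =
  alpha * residue_law R alpha Q j i.+1 + (1 - alpha) * residue_law R alpha Q j i.
Proof. by case: Q => // Q _ /=; rewrite addSnnS residue_law_periodic. Qed.

Lemma residue_law0_sum (R : pzRingType) (alpha : R) (Q : nat) (F : R -> R) :
  (0 < Q)%N -> F 0 = 0 ->
  \sum_(0 <= i < Q) F (residue_law R alpha Q 0 i) = F 1.
Proof.
move=> Q0 F0; rewrite big_ltn //= dvdn0 big_nat big1 ?addr0 // => i /andP[i0 iQ].
by rewrite gtnNdvd.
Qed.

Lemma residue_law_sum (R : comPzRingType) (alpha : R) (Q j : nat) : (0 < Q)%N ->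
  \sum_(0 <= i < Q) residue_law R alpha Q j i = 1.
Proof.
move=> Q0; elim: j => [|j IH]; first exact: (residue_law0_sum _ _ _ id).
rewrite -sum_shift_periodic; last by rewrite -(residue_law_periodic _ _ _ _ 0).
under eq_bigr => i _ do rewrite residue_lawSS //.
rewrite big_split -!mulr_sumr /= sum_shift_periodic ?IH; first by ring.
by rewrite -(residue_law_periodic _ _ _ _ 0).
Qed.

(** Sum over a period the identity (au + (1-a)v)^2 = au^2 + (1-a)v^2 - a(1-a)(u-v)^2; the shifted
    squares have the same sum. *)
Lemma residue_law_energyS (R : comPzRingType) (alpha : R) (Q j : nat) : (0 < Q)%N ->
  \sum_(0 <= i < Q) residue_law R alpha Q j.+1 i ^+ 2 =
  \sum_(0 <= i < Q) residue_law R alpha Q j i ^+ 2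
  - alpha * (1 - alpha) * \sum_(0 <= i < Q)
      (residue_law R alpha Q j i.+1 - residue_law R alpha Q j i) ^+ 2.
Proof.
move=> Q0; have per k : residue_law R alpha Q k Q = residue_law R alpha Q k 0.
  by rewrite -(residue_law_periodic _ _ _ _ 0).
rewrite -[LHS](sum_shift_periodic _ _ (fun i => residue_law R alpha Q j.+1 i ^+ 2));
  last by rewrite per.
transitivity (\sum_(0 <= i < Q) (alpha * residue_law R alpha Q j i.+1 ^+ 2
   + (1 - alpha) * residue_law R alpha Q j i ^+ 2
   - alpha * (1 - alpha) * (residue_law R alpha Q j i.+1 - residue_law R alpha Q j i) ^+ 2)).
  by apply: eq_bigr => i _; rewrite residue_lawSS //; ring.
rewrite sumrB big_split -!mulr_sumr /=.
rewrite (sum_shift_periodic _ _ (fun i => residue_law R alpha Q j i ^+ 2));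
  last by rewrite per.
by ring.
Qed.

(* The energy drops at each step by a multiple of the Dirichlet form, which the
   Poincare inequality compares with the variance; as the variance decreases,
   summing the drops bounds it by [O(1 / n)]. *)
Lemma residue_law_variance (R : realFieldType) (alpha : R) (Q n : nat) :
  (0 < Q)%N -> 0 <= alpha <= 1 ->
  alpha * (1 - alpha) * n%:R *
    (\sum_(0 <= i < Q) residue_law R alpha Q n i ^+ 2 - Q%:R^-1) <= Q%:R ^+ 2.
Proof.
move=> Q0 /andP[a0 a1].
pose S n := \sum_(0 <= i < Q) residue_law R alpha Q n i ^+ 2.
pose D n := \sum_(0 <= i < Q)
  (residue_law R alpha Q n i.+1 - residue_law R alpha Q n i) ^+ 2.
rewrite -/(S n).
have c0 : 0 <= alpha * (1 - alpha) by rewrite mulr_ge0 // subr_ge0.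
have S0 m : 0 <= S m by apply: sumr_ge0 => i _; exact: sqr_ge0.
have D0 m : 0 <= D m by apply: sumr_ge0 => i _; exact: sqr_ge0.
have SS m : S m.+1 = S m - alpha * (1 - alpha) * D m by exact: residue_law_energyS.
have VD m : S m - Q%:R^-1 <= Q%:R ^+ 2 * D m.
  exact: variance_poincare (residue_law_sum _ _ _ _ _).
have S1 : S 0%N = 1 by rewrite [LHS](residue_law0_sum _ _ _ (fun x => x ^+ 2)) ?expr0n ?expr1n.
(* Strengthened for the induction: [1 - S n] is the energy lost so far, and each step adds to it
   exactly the drop that pays for one more variance term. *)
suff H : alpha * (1 - alpha) * n%:R * (S n - Q%:R^-1) <= Q%:R ^+ 2 * (1 - S n).
  apply: le_trans H _; rewrite -[leRHS]mulr1.
  apply: ler_wpM2l; first exact: sqr_ge0.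
  by rewrite gerBl.
move: (alpha * (1 - alpha)) c0 SS => c c0 SS.
elim: n => [|n IH]; first by rewrite mulr0 mul0r S1 subrr mulr0.
have cD : 0 <= c * D n by rewrite mulr_ge0.
have cDn : 0 <= n%:R * (c * (c * D n)) by rewrite !mulr_ge0.
have ccD : 0 <= c * (c * D n) by rewrite mulr_ge0.
have cVD := ler_wpM2l c0 (VD n).
by rewrite SS -natr1; lra.
Qed.

(** The exponent 4 makes the variance at most [Q ^ -2]. A single squared deviation is at most the
    variance, so each mass is within 1/Q of the uniform mass 1/Q. *)
Lemma residue_law_le (R : realFieldType) (alpha : R) (Q n r : nat) :
  (0 < Q)%N -> 0 <= alpha <= 1 -> (r < Q)%N ->
  Q%:R ^+ 4 <= alpha * (1 - alpha) * n%:R ->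
  residue_law R alpha Q n r <= 2 / Q%:R.
Proof.
move=> Q0 a01 rQ le_n; have Qp : 0 < Q%:R :> R by rewrite ltr0n.
have V := residue_law_variance _ alpha Q n Q0 a01.
set u := residue_law R alpha Q n in V *.
pose W := \sum_(0 <= i < Q) (u i - Q%:R^-1) ^+ 2.
have WE : \sum_(0 <= i < Q) u i ^+ 2 - Q%:R^-1 = W.
  rewrite /W; under [RHS]eq_bigr => i _ do rewrite sqrrB.
  rewrite big_split sumrB /= sumrMnl -mulr_suml residue_law_sum // sumr_const_nat subn0.
  by field; rewrite gt_eqF.
rewrite WE in V.
have W0 : 0 <= W by apply: sumr_ge0 => i _; exact: sqr_ge0.
have uW : (u r - Q%:R^-1) ^+ 2 <= W.
  rewrite /W !big_mkord (bigD1 (Ordinal rQ)) //= lerDl.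
  by apply: sumr_ge0 => i _; exact: sqr_ge0.
have {}V : Q%:R ^+ 4 * W <= Q%:R ^+ 2 by exact: le_trans (ler_wpM2r W0 le_n) V.
have : (Q%:R * (u r - Q%:R^-1)) ^+ 2 <= 1.
  rewrite exprMn -(ler_pM2l (exprn_gt0 2 Qp)) mulr1 mulrA -exprD.
  by apply: le_trans V; rewrite ler_wpM2l // exprn_ge0 // ltW.
rewrite mulrBr divff ?gt_eqF // ler_pdivlMr // [u r * _]mulrC => le1.
by nra.
Qed.

(** * The law of [kn x j] modulo Q under the Bernoulli measure *)

Lemma measurable_coord (i : nat) (B : set bool) :
  measurable (coord i @^-1` B : set pascal_path).
Proof. by apply: sub_gen_smallest; exists i, B. Qed.

Lemma knS (x : pascal_path) (n : nat) : kn x n.+1 = (kn x n + coord n x)%N.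
Proof. by rewrite /kn big_ord_recr. Qed.

Lemma measurable_kn (n : nat) (P : set nat) :
  measurable [set x : pascal_path | P (kn x n)].
Proof.
elim: n P => [|n IH] P.
  have [P0|P0] := pselect (P 0%N).
    rewrite (_ : [set _ | _] = setT); first exact: measurableT.
    by apply/seteqP; split => x //= _; rewrite /kn big_ord0.
  rewrite (_ : [set _ | _] = set0); first exact: measurable0.
  by apply/seteqP; split => x //=; rewrite /kn big_ord0.
rewrite (_ : [set _ | _] =
  (coord n @^-1` [set false] `&` [set x | P (kn x n)])
  `|` (coord n @^-1` [set true] `&` [set x | (P \o S) (kn x n)])).
  by apply: measurableU; apply: measurableI; [exact: measurable_coord|exact: IH
    |exact: measurable_coord|exact: IH].
apply/seteqP; split => x /=; rewrite knS; case: (coord n x);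
  rewrite /= ?addn1 ?addn0; intuition congruence.
Qed.

(* Carrying a cylinder on coordinates [>= j] through the induction lets the
   product rule for single coordinates replace the independence of [kn x j] and
   [coord j x]. *)
Lemma kn_residue_cylinder (R : realType) (alpha : R)
    (mu : probability pascal_path R) (Q j i : nat) (s : seq nat)
    (B : nat -> set bool) :
  is_bernoulli alpha mu -> (0 < Q)%N -> uniq s -> all (leq j) s ->
  mu ([set x | kn x j = i %[mod Q]] `&`
      \bigcap_(k in [set` s]) (coord k @^-1` B k)) =
  ((residue_law R alpha Q j i)%:E *
   \prod_(k <- s) mu (coord k @^-1` B k))%E.
Proof.
move=> [mu0 mu1 muI] Q0; elim: j i s B => [|j IH] i s B us js.
  rewrite -(muI s B us) /=; case: (boolP (Q %| i)%N) => Qi.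
    rewrite mul1e; congr (mu _); apply/seteqP; split => [x []//|x xB].
    by split => //=; rewrite /kn big_ord0 mod0n; apply/esym/eqP.
  rewrite mul0e -(measure0 mu); congr (mu _); apply/seteqP; split => // x.
  by move=> [] /=; rewrite /kn big_ord0 mod0n => /esym/eqP; rewrite -/(dvdn _ _) (negPf Qi).
(* The event at level [j.+1] is split by the value [b] of coordinate [j]; each half is an event at
   level [j] whose cylinder also fixes that coordinate. *)
pose C b k := if k == j then [set b] else B k.
have jNs : j \notin s.
  by apply/negP => /(allP js); rewrite ltnn.
have ujs : uniq (j :: s) by rewrite /= jNs.
have jjs : all (leq j) (j :: s).
  by rewrite /= leqnn; apply: sub_all js => k; exact: ltnW.
pose A b i := [set x : pascal_path | kn x j = i %[mod Q]] `&`
  \bigcap_(k in [set` j :: s]) (coord k @^-1` C b k).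
have prodC b : (\prod_(k <- j :: s) mu (coord k @^-1` C b k) =
    mu (coord j @^-1` [set b]) * \prod_(k <- s) mu (coord k @^-1` B k))%E.
  rewrite big_cons {1}/C eqxx; congr (_ * _)%E; apply: eq_big_seq => k ks.
  by rewrite /C; case: eqP => // kj; rewrite -kj ks in jNs.
have mA b i' : measurable (A b i').
  apply: measurableI; first exact: (measurable_kn j (fun k => k = i' %[mod Q])).
  by apply: bigcap_measurableType => k _; exact: measurable_coord.
have modS n : (n.+1 = i %[mod Q]) <-> (n = i + Q.-1 %[mod Q]).
  rewrite -[(n %% Q)%N]modnDr -[X in (n + X)%N](prednK Q0) addnS -addSn.
  split => /eqP H; apply/eqP; first by rewrite eqn_modDr.
  by rewrite eqn_modDr in H.
have inC b x : (\bigcap_(k in [set` j :: s]) (coord k @^-1` C b k)) x <->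
   coord j x = b /\ (\bigcap_(k in [set` s]) (coord k @^-1` B k)) x.
  split => [H|[xb H] k /=].
    split; first by have := H j (mem_head _ _); rewrite /= /C eqxx.
    move=> k ks; have := H k; rewrite /C /=; case: eqP => [kj|_].
      by rewrite -kj (ks : k \in s) in jNs.
    by apply; rewrite inE (ks : k \in s) orbT.
  rewrite inE /C => /orP[/eqP ->|ks]; first by rewrite eqxx.
  by case: eqP => [kj|_]; [rewrite -kj ks in jNs|exact: H].
rewrite (_ : _ `&` _ = A false i `|` A true (i + Q.-1)%N); last first.
  apply/seteqP; split => x.
    rewrite /= knS => -[xi xB]; case xj : (coord j x) xi => xi.
      by right; split; [apply/modS; rewrite -addn1|exact/inC].
    by left; split; [rewrite addn0 in xi|exact/inC].
  rewrite /= knS => -[] [/= xi /inC[-> xB]]; split => //.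
    by rewrite addn0.
  by rewrite addn1; apply/modS.
have A01 : A false i `&` A true (i + Q.-1)%N = set0.
  by rewrite -subset0 => x [[_ /inC[xf _]] [_ /inC[]]]; rewrite xf.
transitivity (mu (A false i) + mu (A true (i + Q.-1)%N))%E; first exact: measureU.
have EA b i' : mu (A b i') = ((residue_law R alpha Q j i')%:E *
   \prod_(k <- j :: s) mu (coord k @^-1` C b k))%E by exact: IH.
rewrite !EA !prodC mu0 mu1 !muleA -!EFinM.
have finE : (\prod_(k <- s) mu (coord k @^-1` B k))%E \is a fin_num.
  rewrite -(muI s B us) fin_num_measure //.
  by apply: bigcap_measurableType => k _; exact: measurable_coord.
rewrite -(fineK finE) -!EFinM -EFinD /=; congr EFin; ring.
Qed.

Lemma kn_residue_law (R : realType) (alpha : R)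
    (mu : probability pascal_path R) (Q j i : nat) :
  is_bernoulli alpha mu -> (0 < Q)%N ->
  mu [set x | kn x j = i %[mod Q]] = (residue_law R alpha Q j i)%:E.
Proof.
move=> mub Q0.
have := kn_residue_cylinder _ _ _ Q j i [::] (fun=> setT) mub Q0 isT isT.
rewrite big_nil mule1 => <-; congr (mu _); apply/seteqP.
by split => [x kx|x []//]; split => // k.
Qed.

(** * Levels at which [q] does not divide [dn x j] *)

Definition ndvd_dn (q j : nat) : set pascal_path :=
  [set x | ~~ (q %| dn x j)%N].

Lemma measurable_ndvd_dn (q j : nat) : measurable (ndvd_dn q j).
Proof. exact: (measurable_kn j (fun k => ~~ (q %| 'C(j, k))%N)). Qed.

(** The Lucas step confines the event to residues [r] of [kn x j] with ['C(j %% q ^ h, r)] prime to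
    [q]; then a union bound applies. *)
Lemma ndvd_dn_le_sum (R : realType) (alpha : R)
    (mu : probability pascal_path R) (q h j : nat) :
  is_bernoulli alpha mu -> prime q ->
  (mu (ndvd_dn q j) <= (\sum_(r < q ^ h)
    (~~ (q %| 'C(j %% q ^ h, r)))%N%:R * residue_law R alpha (q ^ h) j r)%:E)%E.
Proof.
move=> mub q_pr; have Q0 : (0 < q ^ h)%N by rewrite expn_gt0 prime_gt0.
pose F r := if (q %| 'C(j %% q ^ h, r))%N then set0
            else [set x : pascal_path | kn x j = r %[mod q ^ h]].
have mF r : measurable (F r).
  rewrite /F; case: ifP => _ //.
  exact: (measurable_kn j (fun k => k = r %[mod q ^ h])).
have sub : ndvd_dn q j `<=` \big[setU/set0]_(r < q ^ h) F r.
  move=> x; rewrite /ndvd_dn /dn /= => nd; rewrite -bigcup_mkord.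
  exists (kn x j %% q ^ h)%N; first by rewrite /= ltn_mod.
  rewrite /F; case: ifPn => [dv|_] /=; last by rewrite modn_mod.
  by rewrite (dvdn_bin_modn_exp q h) in nd.
apply: (le_trans (content_subadditive mu (fun r _ => mF r) (measurable_ndvd_dn q j) sub)).
rewrite -sumEFin; apply: lee_sum => r _; rewrite /F; case: ifPn => _.
  by rewrite measure0 mul0r.
by rewrite mul1r -(kn_residue_law _ alpha mu).
Qed.

Lemma ndvd_dn_le (R : realType) (alpha : R)
    (mu : probability pascal_path R) (q h j : nat) :
  is_bernoulli alpha mu -> 0 <= alpha <= 1 -> prime q ->
  (q ^ h)%:R ^+ 4 <= alpha * (1 - alpha) * j%:R ->
  (mu (ndvd_dn q j) <= ((\sum_(r < q ^ h) ~~ (q %| 'C(j %% q ^ h, r)))%N%:R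
    * (2 / (q ^ h)%:R))%:E)%E.
Proof.
move=> mub a01 q_pr Qj; have Q0 : (0 < q ^ h)%N by rewrite expn_gt0 prime_gt0.
apply: (le_trans (ndvd_dn_le_sum _ _ _ _ h _ mub q_pr)).
rewrite lee_fin natr_sum mulr_suml; apply: ler_sum => r _.
by rewrite ler_wpM2l // residue_law_le.
Qed.

(* Up to level [K Q ^ 4] the probabilities are only bounded by 1. *)
Lemma sum_ndvd_dn_le (R : realType) (alpha : R)
    (mu : probability pascal_path R) (q h K : nat) :
  is_bernoulli alpha mu -> 0 <= alpha <= 1 -> prime q ->
  1 <= alpha * (1 - alpha) * K%:R ->
  (\sum_(j < (q ^ h) ^ 5) mu (ndvd_dn q j) <=
    (((q ^ h) ^ 5)%:R * ((K%:R + 2) * ((q ^ 2).-1%:R / (q ^ 2)%:R) ^+ h))%:E)%E.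
Proof.
move=> mub a01 q_pr cK; set Q := (q ^ h)%N; have q1 := prime_gt1 q_pr.
have Q0 : (0 < Q)%N by rewrite expn_gt0 prime_gt0.
pose w s := (\sum_(r < Q) ~~ (q %| 'C(s, r)))%N.
pose b j : R := (j < K * Q ^ 4)%N%:R + (w (j %% Q)%N)%:R * (2 / Q%:R).
have mb (j : 'I_(Q ^ 5)) : true -> (mu (ndvd_dn q j) <= (b j)%:E)%E.
  move=> _; rewrite /b; case: ltnP => jK.
    apply: (@le_trans _ _ 1%E); first exact: probability_le1 (measurable_ndvd_dn q j).
    by rewrite lee_fin lerDl mulr_ge0 // divr_ge0.
  rewrite add0r; apply: (ndvd_dn_le _ alpha) => //.
  have KQ : (K * Q ^ 4)%:R <= j%:R :> R by rewrite ler_nat.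
  have c0 : 0 <= alpha * (1 - alpha) by case/andP: a01 => *; rewrite mulr_ge0 // subr_ge0.
  apply: le_trans (ler_wpM2l c0 KQ); rewrite natrM (natrX _ Q 4) mulrA -[leLHS]mul1r.
  by apply: ler_wpM2r => //; exact: exprn_ge0.
apply: (le_trans (lee_sum _ mb)); rewrite sumEFin lee_fin big_split /=.
rewrite -natr_sum -mulr_suml -natr_sum.
have KM : (\sum_(j < Q ^ 5) (j < K * Q ^ 4) <= K * Q ^ 4)%N.
  apply: leq_trans (geq_minr (Q ^ 5) _).
  move: (Q ^ 5)%N (K * Q ^ 4)%N => n M.
  elim: n => [|n IH]; first by rewrite big_ord0.
  by rewrite big_ord_recr /=; move: (\sum_(j < n) _)%N IH => s; lia.
(* The levels below [Q ^ 5] form [Q ^ 4] full periods, and the sum of [w] over one period is the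
   count of [sum_bin_ndvdn_le]. *)
have wP : (\sum_(j < Q ^ 5) w (j %% Q) <= Q ^ 4 * (q ^ 2).-1 ^ h)%N.
  rewrite (expnSr Q 4) (sum_nat_divmod _ _ (fun j => w (j %% Q)%N)).
  under eq_bigr => a _ do under eq_bigr => s _ do rewrite modnMDl modn_small //.
  by rewrite sum_nat_const card_ord leq_mul // sum_bin_ndvdn_le.
(* This absorbs the initial segment: [K * Q ^ 4] is at most [K * Q ^ 3 * (q ^ 2).-1 ^ h], of the
   same order as the main term. *)
have QP : (Q <= (q ^ 2).-1 ^ h)%N.
  rewrite /Q; have [->|h0] := posnP h; first by rewrite !expn0.
  by rewrite leq_exp2r // -mulnn; nia.
have Qp : 0 < Q%:R :> R by rewrite ltr0n.
have E : (Q ^ 5)%:R * ((q ^ 2).-1%:R / (q ^ 2)%:R) ^+ h =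
    Q%:R ^+ 3 * ((q ^ 2).-1 ^ h)%:R :> R.
  have q2Q : (q ^ 2)%:R ^+ h = Q%:R ^+ 2 :> R by rewrite -!natrX -!expnM mulnC.
  rewrite expr_div_n q2Q (natrX _ Q 5) (natrX _ (q ^ 2).-1 h).
  by field; rewrite gt_eqF.
rewrite [leRHS]mulrCA E.
move: KM wP QP; rewrite -!(ler_nat R) natrM (natrM _ (Q ^ 4)) (natrX _ Q 4) => KM wP QP.
have wP' := ler_wpM2r (divr_ge0 (ler0n _ 2) (ltW Qp)) wP.
apply: (le_trans (lerD KM wP')).
rewrite [X in _ + X](_ : _ = 2 * (Q%:R ^+ 3 * ((q ^ 2).-1 ^ h)%:R)); last first.
  by field; rewrite gt_eqF.
rewrite [leRHS]mulrDl lerD2r ler_wpM2l // exprSr ler_wpM2l // exprn_ge0.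
Qed.

(** * From arithmetic and expectations to almost sure averages *)

Lemma normc_expi_sub1_le (R : realType) (q d : nat) : (0 < q)%N ->
  ComplexField.Normc.normc (expi (2 * pi * d%:R / q%:R) - 1) <=
  2 * (~~ (q %| d))%N%:R :> R.
Proof.
move=> q0; case: (boolP (q %| d)%N) => [/dvdnP[m ->]|_].
  have qR0 : q%:R != 0 :> R by rewrite pnatr_eq0 -lt0n.
  have -> : 2 * pi * (m * q)%:R / q%:R = 0 + (pi *+ 2) *+ m :> R.
    by rewrite natrM; field.
  rewrite /expi.
  have [-> ->] : cos (0 + pi *+ 2 *+ m) = 1 :> R /\ sin (0 + pi *+ 2 *+ m) = 0 :> R.
    elim: m => [|m [IHc IHs]]; first by rewrite mulr0n addr0 cos0 sin0.
    by rewrite mulrSr addrA cosD2pi sinD2pi.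
  by rewrite (_ : Complex 1 0 = 1) // subrr ComplexField.Normc.normc0 mulr0.
rewrite mulr1; apply: (le_trans (le_normcD _ _)).
rewrite normcN ComplexField.Normc.normc1 /= cos2Dsin2 sqrtr1; lra.
Qed.

(** For [n] between [b ^ h] and [b ^ h.+1], bound [G n] by [G (b ^ h.+1)]; replacing [b ^ h.+1] by
    [n] in the denominator costs a factor [b], hence the tolerance [e / b]. *)
Lemma cvg_average_lacunary (R : realType) (b : nat) (G : nat -> R) :
  (1 < b)%N -> {homo G : m n / (m <= n)%N >-> m <= n} -> 0 <= G 0%N ->
  ((b ^ h)%:R^-1 * G (b ^ h)%N @[h --> \oo] --> (0 : R)) ->
  (n%:R^-1 * G n @[n --> \oo] --> (0 : R)).
Proof.
move=> b1 Gh G0 /cvgrPdist_le Gb; apply/cvgrPdist_le => e e0.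
have b0 : 0 < b%:R :> R by rewrite ltr0n ltnW.
have G_ge0 n : 0 <= G n by apply: le_trans G0 (Gh _ _ _).
have [H _ HG] := Gb (e / b%:R) (divr_gt0 e0 b0).
exists (b ^ H)%N => // n /= bn.
have n0 : (0 < n)%N by apply: leq_trans bn; rewrite expn_gt0 ltnW.
have nR0 : 0 < n%:R :> R by rewrite ltr0n.
rewrite sub0r normrN ger0_norm ?mulr_ge0 ?invr_ge0 //.
rewrite mulrC ler_pdivrMr //.
have /andP[le_n n_lt] := trunc_log_bounds b1 n0; set h := trunc_log b n in le_n n_lt.
have Hh : (H <= h.+1)%N by apply: leqW; rewrite /h -(trunc_expnK H b1) leq_trunc_log.
have := HG h.+1 Hh.
rewrite sub0r normrN ger0_norm ?mulr_ge0 ?invr_ge0 //.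
have bh0 : 0 < (b ^ h.+1)%:R :> R by rewrite ltr0n expn_gt0 ltnW.
rewrite mulrC ler_pdivrMr // => Gle.
apply: (le_trans (Gh _ _ (ltnW n_lt))); apply: (le_trans Gle).
rewrite expnS natrM mulrA divfK ?gt_eqF //.
by rewrite ler_wpM2l ?ler_nat // ltW.
Qed.

(** By monotone convergence the sum of the [f h] has integral at most [C / (1 - rho)], so it is
    finite almost everywhere and its terms tend to 0. *)
Lemma ae_cvg0_geometric_integral (R : realType) (d : measure_display)
    (T : measurableType d) (mu : {measure set T -> \bar R})
    (f : nat -> T -> R) (C rho : R) :
  (forall h, measurable_fun setT (f h)) -> (forall h x, 0 <= f h x) ->
  0 < rho < 1 -> (forall h, \int[mu]_x (f h x)%:E <= (C * rho ^+ h)%:E)%E ->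
  {ae mu, forall x, f h x @[h --> \oo] --> (0 : R)}.
Proof.
move=> mf f0 /andP[rho0 rho1] fle.
have mfE h : measurable_fun setT (fun x => (f h x)%:E) by exact/measurable_EFinP.
have fE0 h x : setT x -> (0 <= (f h x)%:E)%E by rewrite lee_fin.
pose F x := (\sum_(h <oo) (f h x)%:E)%E.
have F0 x : (0 <= F x)%E by apply: nneseries_ge0 => h _ _; exact: fE0.
have C0 : 0 <= C.
  have := le_trans (integral_ge0 mu (fE0 0%N)) (fle 0%N).
  by rewrite lee_fin expr0 mulr1.
have intF : mu.-integrable setT F.
  apply/integrableP; split.
    exact: (ge0_emeasurable_sum (P := xpredT) (fun k x Dx _ => fE0 k x Dx) (fun k _ => mfE k)).
  under eq_integral => x _ do rewrite gee0_abs //.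
  rewrite (integral_nneseries mu measurableT mfE fE0).
  apply: (@le_lt_trans _ _ (C / (1 - rho))%:E); last exact: ltry.
  apply: lime_le.
    by apply: is_cvg_nneseries => h _ _; apply: integral_ge0 => x Dx; exact: fE0.
  apply: nearW => n; apply: (@le_trans _ _ (\sum_(0 <= h < n) (C * rho ^+ h)%:E)%E).
    by apply: lee_sum => h _; exact: fle.
  rewrite sumEFin lee_fin.
  have rho_lt1 : `|rho| < 1 by rewrite gtr0_norm.
  exact: (geometric_le_lim n C0 rho0 rho_lt1).
have := integrable_ae measurableT intF.
apply: filterS => x /(_ I) Fx.
apply: cvg_series_cvg_0; apply: nondecreasing_is_cvgn.
  by apply: nondecreasing_series => k _ _; exact: f0.
exists (fine (F x)) => _ [n _ <-].
rewrite -lee_fin fineK // /series /= -sumEFin.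
apply: nneseries_lim_ge => k _ _; rewrite lee_fin; exact: f0.
Qed.

Theorem theorem3p1 (R : realType) (q : nat) (q_prime : prime q)
    (alpha : R) (alpha_gt0 : 0 < alpha) (alpha_lt1 : alpha < 1)
    (mu : probability pascal_path R) (mu_bernoulli : is_bernoulli alpha mu) :
  {ae mu, forall x : pascal_path,
    (fun n : nat => n%:R^-1 *
       \sum_(0 <= j < n)
          ComplexField.Normc.normc
            (expi (2 * pi * (dn x j)%:R / q%:R) - 1)) @ \oo --> (0 : R)}.
Proof.
have q1 := prime_gt1 q_prime; have q0 := ltnW q1.
have a01 : 0 <= alpha <= 1 by rewrite !ltW.
pose c := alpha * (1 - alpha).
have c0 : 0 < c by rewrite mulr_gt0 // subr_gt0.
(* Truncation rounds down, so the successor [K1] exceeds [c^-1], as the threshold [K1 * Q ^ 4]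
   requires. *)
pose K := Num.trunc c^-1; pose K1 := K.+1.
have cK : 1 <= c * K1%:R.
  rewrite mulrC -ler_pdivrMr // div1r ltW //.
  by apply: truncnS_gt.
pose ind j : pascal_path -> R := \1_(ndvd_dn q j).
pose G x n := \sum_(j < n) ind j x.
pose f h x := ((q ^ 5) ^ h)%:R^-1 * G x ((q ^ 5) ^ h)%N.
have mind j : measurable_fun setT (ind j).
  exact: measurable_indic (measurable_ndvd_dn q j).
have mG n : measurable_fun setT (G ^~ n) by exact: measurable_sum.
have ind0 j x : 0 <= ind j x by rewrite /ind indicE ler0n.
have G0 x n : 0 <= G x n by apply: sumr_ge0.
pose rho : R := (q ^ 2).-1%:R / (q ^ 2)%:R.
have q2 : (1 < q ^ 2)%N by rewrite -{1}(expn0 q) ltn_exp2l.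
have rho01 : 0 < rho < 1.
  have q2R : 0 < (q ^ 2)%:R :> R by rewrite ltr0n ltnW.
  rewrite divr_gt0 //; last by rewrite ltr0n; lia.
  by rewrite ltr_pdivrMr // mul1r ltr_nat; lia.
have fint h : (\int[mu]_x (f h x)%:E <= ((K1%:R + 2) * rho ^+ h)%:E)%E.
  have N0 : 0 < ((q ^ 5) ^ h)%:R :> R by rewrite ltr0n !expn_gt0 q0.
  under eq_integral => x _ do rewrite /f EFinM.
  rewrite ge0_integralZl_EFin //; last 2 first.
  - by move=> x _; rewrite lee_fin.
  - exact/measurable_EFinP.
  rewrite /G; under eq_integral => x _ do rewrite -sumEFin.
  rewrite ge0_integral_sum //; last 2 first.
  - by move=> j; exact/measurable_EFinP.
  - by move=> j x _; rewrite lee_fin.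
  have Eind j : (\int[mu]_x (ind j x)%:E)%E = mu (ndvd_dn q j).
    by rewrite integral_indic ?setIT //; exact: measurable_ndvd_dn.
  under eq_bigr => j _ do rewrite Eind.
  (* The number of levels [(q ^ 5) ^ h] is rewritten as [(q ^ h) ^ 5], that is [Q ^ 5]. *)
  rewrite lee_pdivrMl // -EFinM -expnM mulnC expnM.
  exact: (sum_ndvd_dn_le _ alpha).
have mf h : measurable_fun setT (f h) by exact: measurable_funM.
have f0 h x : 0 <= f h x by rewrite mulr_ge0 // invr_ge0.
have := ae_cvg0_geometric_integral _ _ _ mu f _ _ mf f0 rho01 fint.
apply: filterS => x fx0.
have Gx : {homo G x : m n / (m <= n)%N >-> m <= n}.
  move=> m n mn; rewrite /G -!(big_mkord xpredT (fun j => ind j x)).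
  by rewrite (@big_cat_nat _ _ _ m 0 n) //= lerDl sumr_ge0.
have q51 : (1 < q ^ 5)%N by rewrite -{1}(expn0 q) ltn_exp2l.
have avg0 := cvg_average_lacunary _ _ _ q51 Gx (G0 x 0%N) fx0.
(* Each summand is at most twice the indicator of [ndvd_dn q j], so the average lies between 0 and
   twice the proportion of bad levels. *)
apply: (@squeeze_cvgr _ _ _ _ (fun=> 0) (fun n => 2 * (n%:R^-1 * G x n))).
- apply: nearW => n; apply/andP; split.
    by rewrite mulr_ge0 ?invr_ge0 // sumr_ge0 // => j _; exact: sqrtr_ge0.
  rewrite mulrCA ler_wpM2l ?invr_ge0 // big_mkord mulr_sumr.
  apply: ler_sum => j _; apply: (le_trans (normc_expi_sub1_le _ _ _ q0)).
  rewrite ler_wpM2l // /ind indicE.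
  by case: (boolP (q %| dn x j)%N) => nd; rewrite ?ler0n // mem_set.
- exact: (@cvg_cst R).
- by rewrite -[X in _ --> X](mulr0 2); exact: cvgMr avg0.
Qed.
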